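(* Let $B$ be a simple Bratteli diagram and $G$ its dimension group. Suppose that there is a perfect order $\omega$ on $B$ with exactly $j$ maximal paths and exactly $j$ minimal paths, where $j\ge 2$ (that is, $\omega\in\mathcal P_B\cap\mathcal O_B(j)$). Then the infinitesimal subgroup $\mathrm{Inf}(G)$ of $G$ contains a subgroup isomorphic to $\mathbb Z^{j-1}$.
   Context: A Bratteli diagram $B=(V,E)$ is an infinite graph with $V=\bigsqcup_{i\ge 0}V_i$, $E=\bigsqcup_{i\ge 1}E_i$, all $V_i,E_i$ finite, $V_0=\{v_0\}$, and range and source maps $r,s:E\to V$ with $r(E_i)=V_i$, $s(E_i)=V_{i-1}$, $s^{-1}(v)\ne\emptyset$ for all $v\in V$, $r^{-1}(v)\neq\emptyset$ for all $v\in V\setminus V_0$. A path is a sequence of edges with $r(e_i)=s(e_{i+1})$. $X_B$ is the space of infinite paths starting at $v_0$, with the topology generated by cylinder sets. The incidence matrix $F_n=(f^{(n)}_{v,w})_{v\in V_{n+1},w\in V_n}$, $n\ge0$, has $f^{(n)}_{v,w}=|\{e\in E_{n+1}: r(e)=v,s(e)=w\}|$. $B$ is simple if for every $n$ there is $m>n$ such that every $v\in V_n$ and $w\in V_m$ are joined by a path. An order $\omega$ on $B$ is a choice of linear order on each $r^{-1}(v)$, $v\in V\setminus V_0$. A path is maximal (minimal) if each of its edges $e_i$ is maximal (minimal) in $r^{-1}(r(e_i))$; $X_{\max}(\omega),X_{\min}(\omega)$ are the sets of maximal and minimal infinite paths in $X_B$. $\mathcal O_B(j)$ is the set of orders $\omega$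 on $B$ with $|X_{\max}(\omega)|=|X_{\min}(\omega)|=j$. Standing assumptions: $X_B$ has no isolated points; $B$ is aperiodic (every tail equivalence class in $X_B$, where $x\sim y$ iff $x_n=y_n$ for all large $n$, is infinite); $B$ is regular (for every order $\omega$ on $B$, $X_{\max}(\omega)$ and $X_{\min}(\omega)$ have empty interior). A Vershik map for $\omega$ is a homeomorphism $\varphi_\omega:X_B\to X_B$ with $\varphi_\omega(X_{\max}(\omega))=X_{\min}(\omega)$ and, for $x\notin X_{\max}(\omega)$, $\varphi_\omega(x)=(x_1^0,\dots,x_{k-1}^0,\overline{x_k},x_{k+1},\dots)$, where $k$ is least with $x_k$ not maximal, $\overline{x_k}$ is the successor of $x_k$ in $r^{-1}(r(x_k))$ and $(x_1^0,\dots,x_{k-1}^0)$ is the minimal path from $v_0$ to $s(\overline{x_k})$. $\omega$ is perfect if it admits a Vershik map; $\mathcal P_B$ is the set of perfect orders on $B$. The dimension group of $B$ is the (ordered) direct limit $G=\varinjlim(\mathbb Z^{|V_n|}\xrightarrow{F_n}\mathbb Z^{|V_{n+1}|})$, each $\mathbb Z^{|V_n|}$ having the coordinatewise order, with order unit the class of $1\in\mathbb Z^{|V_0|}=\mathbb Z$. A normalized trace on $G$ is a positive homomorphism $\tau:G\to\mathbb R$ taking the value $1$ on the order unit (equivalently, it is given by a probability measure on $X_B$ invariant under tail equivalence). $\mathrm{Inf}(G)=\{g\in G:\tau(g)=0\text{ for every normalized trace }\tau\text{ on }G\}$. *)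

(* Defs.v *)
From HB Require Import structures.
From mathcomp Require Import all_boot all_order all_algebra generic_quotient.
From mathcomp Require Import boolp classical_sets functions cardinality.
From mathcomp Require Import reals topology.

Set Implicit Arguments.
Unset Strict Implicit.
Unset Printing Implicit Defensive.

Import Order.TTheory GRing.Theory Num.Theory.
Local Open Scope classical_set_scope.
Local Open Scope card_scope.
Local Open Scope ring_scope.
Local Open Scope quotient_scope.

Section DirectLimit.
Variables (A : nat -> zmodType) (f : forall n, {additive A n -> A n.+1}).

Definition at_level (a : {n & A n}) (m : nat) : A m :=
  @untag nat (fun n => A n) (A m) 0 m id a.

(* [push a m] is the image of [a : A n] in [A m] under [f n], ..., [f m.-1]
   if [n <= m], and is [0] if [m < n]. *)
Fixpoint push (a : {n & A n}) (m : nat) : A m :=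
  if m is k.+1 then f k (push a k) + at_level a k.+1 else at_level a 0.

Lemma at_level_tagged n (x : A n) : at_level (Tagged A x) n = x.
Proof. by rewrite /at_level (untagE _ _ (erefl : tag (Tagged A x) = n)). Qed.

Lemma at_level_neq (a : {n & A n}) m : tag a != m -> at_level a m = 0.
Proof. by move=> am; rewrite /at_level untag_dflt. Qed.

Lemma push_lt a m : (m < tag a)%N -> push a m = 0.
Proof.
elim: m => [|m IHm] lt_ma /=; first by rewrite at_level_neq // gtn_eqF.
by rewrite IHm ?(ltnW lt_ma)// raddf0 add0r at_level_neq // gtn_eqF.
Qed.

Lemma push_tag n (x : A n) : push (Tagged A x) n = x.
Proof.
case: n x => [|n] x /=; first exact: at_level_tagged.
by rewrite push_lt ?ltnSn // raddf0 add0r at_level_tagged.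
Qed.

Lemma pushS a m : (tag a <= m)%N -> push a m.+1 = f m (push a m).
Proof. by move=> le_am; rewrite /= at_level_neq ?addr0 // ltn_eqF. Qed.

Lemma push_push a m k :
  (tag a <= m)%N -> (m <= k)%N -> push (Tagged A (push a m)) k = push a k.
Proof.
move=> le_am; elim: k => [|k IHk]; rewrite leq_eqVlt.
  by rewrite orbF => /eqP <-; rewrite push_tag.
case/orP=> [/eqP <-|lt_mk]; first by rewrite push_tag.
by rewrite !pushS ?IHk // (leq_trans le_am).
Qed.

Lemma pushD n (x y : A n) m :
  push (Tagged A (x + y)) m = push (Tagged A x) m + push (Tagged A y) m.
Proof.
case: (ltnP m n) => [lt_mn|]; first by rewrite !push_lt // addr0.
elim: m => [|m IHm]; rewrite leq_eqVlt.
  by rewrite orbF => /eqP E; subst n; rewrite !push_tag.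
case/orP=> [/eqP E|lt_nm]; first by subst n; rewrite !push_tag.
by rewrite !pushS // IHm // raddfD.
Qed.

Definition dirlim_eq (a b : {n & A n}) : bool :=
  `[< exists m, [/\ (tag a <= m)%N, (tag b <= m)%N & push a m = push b m] >].

Lemma push_eqW a b m k : (tag a <= m)%N -> (tag b <= m)%N -> (m <= k)%N ->
  push a m = push b m -> push a k = push b k.
Proof.
by move=> am bm mk E; rewrite -(push_push am mk) -(push_push bm mk) E.
Qed.

Lemma dirlim_eq_equiv : equiv_class_of dirlim_eq.
Proof.
split=> [a|a b|b a c].
- by apply/asboolP; exists (tag a).
- by apply/asboolP/asboolP => -[m [? ? ?]]; exists m.
- move=> /asboolP[m [am bm E]] /asboolP[k [bk ck E']]; apply/asboolP.
  exists (maxn m k); split; rewrite ?leq_max ?am ?ck ?orbT //.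
  by rewrite (push_eqW am bm _ E) ?leq_maxl // (push_eqW bk ck _ E') ?leq_maxr.
Qed.

Canonical dirlim_equiv := EquivRelPack dirlim_eq_equiv.
Canonical dirlim_encModRel := defaultEncModRel dirlim_eq.

Definition dirlim : Type := {eq_quot dirlim_eq}.
HB.instance Definition _ := Choice.on dirlim.
HB.instance Definition _ : EqQuotient _ dirlim_eq dirlim :=
  EqQuotient.on dirlim.

Definition dirlim_in n (x : A n) : dirlim := \pi_dirlim (Tagged A x).

Lemma dirlim_inP n (x : A n) m (y : A m) :
  dirlim_in x = dirlim_in y <->
  exists k, [/\ (n <= k)%N, (m <= k)%N &
                push (Tagged A x) k = push (Tagged A y) k].
Proof.
rewrite /dirlim_in; split=> [/eqP|E].
  by rewrite piE => /asboolP.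
by apply/eqP; rewrite piE; apply/asboolP.
Qed.

Lemma dirlim_in_push a m :
  (tag a <= m)%N -> dirlim_in (push a m) = \pi_dirlim a.
Proof.
by case: a => n x /= nm; apply/dirlim_inP; exists m; rewrite push_tag.
Qed.

Lemma dirlim_in_step n (x : A n) : dirlim_in (f n x) = dirlim_in x.
Proof.
apply/dirlim_inP; exists n.+1; split => //.
by rewrite push_tag pushS // push_tag.
Qed.

Lemma dirlim_surj (g : dirlim) : exists n (x : A n), g = dirlim_in x.
Proof.
exists (tag (repr g)), (tagged (repr g)).
by rewrite /dirlim_in; case E : (repr g) => [n x] /=; rewrite -[LHS]reprK E.
Qed.

Definition dirlim_zero : dirlim := dirlim_in (0 : A 0).

Definition dirlim_opp (g : dirlim) : dirlim :=
  dirlim_in (- tagged (repr g)).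

Definition dirlim_add (g h : dirlim) : dirlim :=
  let m := maxn (tag (repr g)) (tag (repr h)) in
  dirlim_in (push (repr g) m + push (repr h) m).

Lemma dirlim_surj2 (g h : dirlim) :
  exists n (x y : A n), g = dirlim_in x /\ h = dirlim_in y.
Proof.
pose m := maxn (tag (repr g)) (tag (repr h)).
exists m, (push (repr g) m), (push (repr h) m).
by rewrite !dirlim_in_push ?leq_maxl ?leq_maxr // !reprK.
Qed.

Lemma dirlim_add_in n (x y : A n) :
  dirlim_add (dirlim_in x) (dirlim_in y) = dirlim_in (x + y).
Proof.
rewrite /dirlim_add; set a := repr (dirlim_in x); set b := repr _.
have /eqP := reprK (dirlim_in x); rewrite {2}/dirlim_in -/a piE.
have /eqP := reprK (dirlim_in y); rewrite {2}/dirlim_in -/b piE.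
move=> /asboolP[k /= [bk nk Eb]] /asboolP[l /= [al nl Ea]].
set m := maxn _ _; pose p := maxn m (maxn k l).
have [mp kp lp] : [/\ m <= p, k <= p & l <= p]%N.
  split; first exact: leq_maxl.
    exact: leq_trans (leq_maxl _ _) (leq_maxr _ _).
  exact: leq_trans (leq_maxr _ _) (leq_maxr _ _).
have am : (tag a <= m)%N by rewrite leq_maxl.
have bm : (tag b <= m)%N by rewrite leq_maxr.
apply/dirlim_inP; exists p; rewrite !pushD (leq_trans nk kp); split=> //.
rewrite !push_push //.
by rewrite (@push_eqW a (Tagged A x) l) // (@push_eqW b (Tagged A y) k).
Qed.

Lemma dirlim_in0 n : dirlim_in (0 : A n) = dirlim_zero.
Proof.
apply/dirlim_inP; exists n; split => //; rewrite push_tag.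
by elim: n => [|n IHn]; rewrite ?push_tag // pushS // -IHn raddf0.
Qed.

Lemma dirlim_opp_add g : dirlim_add (dirlim_opp g) g = dirlim_zero.
Proof.
have E : g = dirlim_in (tagged (repr g)).
  by rewrite -[LHS]reprK /dirlim_in; case: (repr g).
by rewrite /dirlim_opp [X in dirlim_add _ X]E dirlim_add_in addNr dirlim_in0.
Qed.

Lemma dirlim_addC : commutative dirlim_add.
Proof.
move=> g h; have [n [x [y [-> ->]]]] := dirlim_surj2 g h.
by rewrite !dirlim_add_in addrC.
Qed.

Lemma dirlim_add0 : left_id dirlim_zero dirlim_add.
Proof.
move=> g; have [n [x ->]] := dirlim_surj g.
by rewrite -(dirlim_in0 n) dirlim_add_in add0r.
Qed.

Lemma dirlim_addA : associative dirlim_add.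
Proof.
move=> g h i; have [n [x [y [-> ->]]]] := dirlim_surj2 g h.
have [m [z ->]] := dirlim_surj i.
pose p := maxn n m.
have E k (t : A k) : (k <= p)%N ->
    dirlim_in t = dirlim_in (push (Tagged A t) p).
  by move=> kp; rewrite dirlim_in_push.
by rewrite (E _ x) ?(E _ y) ?(E _ z) ?leq_maxl ?leq_maxr // !dirlim_add_in addrA.
Qed.

HB.instance Definition _ :=
  GRing.isZmodule.Build dirlim dirlim_addA dirlim_addC dirlim_add0
    dirlim_opp_add.

Lemma dirlim_in_additive n : zmod_morphism (@dirlim_in n).
Proof.
move=> x y; apply: (addIr (dirlim_in y)); rewrite subrK.
by rewrite [LHS]dirlim_add_in subrK.
Qed.

HB.instance Definition _ n :=
  GRing.isZmodMorphism.Build (A n) dirlim (@dirlim_in n)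
    (@dirlim_in_additive n).

End DirectLimit.

(* [edge n] is the set of edges between levels [n] and [n.+1], that is, the
   set usually written E_(n+1). *)
Record bratteli := Bratteli {
  vertex : nat -> finType;
  edge : nat -> finType;
  src : forall n, edge n -> vertex n;
  rng : forall n, edge n -> vertex n.+1;
  card_vertex0 : #|vertex 0| = 1%N;
  src_surj : forall n (v : vertex n), exists e, src e = v;
  rng_surj : forall n (v : vertex n.+1), exists e, rng e = v
}.
Arguments src {b n}.
Arguments rng {b n}.

Inductive joined (B : bratteli) n (v : vertex B n) :
    forall m, vertex B m -> Prop :=
  | joined_refl : joined v v
  | joined_edge m (e : edge B m) : joined v (src e) -> joined v (rng e).

Definition simple_bratteli (B : bratteli) : Prop :=
  forall n, exists2 m, (n < m)%N &
    forall (v : vertex B n) (w : vertex B m), joined v w.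

(* The starting vertex of a path is the only element of [vertex B 0]. *)
Record inf_path (B : bratteli) := InfPath {
  path_edge :> forall n, edge B n;
  path_adj : forall n, rng (path_edge n) = src (path_edge n.+1)
}.

HB.instance Definition _ (B : bratteli) := gen_eqMixin (inf_path B).
HB.instance Definition _ (B : bratteli) := gen_choiceMixin (inf_path B).

(* As every finite path starting at the root extends to an infinite one, these
   are all the cylinder sets. *)
Definition cylinder (B : bratteli) (x : inf_path B) (n : nat) :
    set (inf_path B) :=
  [set y | forall i, (i < n)%N -> y i = x i].

Definition cylinders (B : bratteli) : set (set (inf_path B)) :=
  [set C | exists x n, C = cylinder x n].

HB.instance Definition _ (B : bratteli) :=
  isSubBaseTopological.Build (inf_path B) (@cylinders B) id.

Definition tail_equiv (B : bratteli) (x y : inf_path B) : Prop :=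
  \forall n \near \oo, x n = y n.

Definition aperiodic (B : bratteli) : Prop :=
  forall x : inf_path B, infinite_set [set y | tail_equiv x y].

(* The linear orders on the fibres of [rng] are packed in one relation per
   level, under which edges with distinct ranges are not comparable. *)
Record bratteli_order (B : bratteli) := BratteliOrder {
  ole : forall n, rel (edge B n);
  ole_rng : forall n (e f : edge B n), ole e f -> rng e = rng f;
  ole_refl : forall n, reflexive (@ole n);
  ole_anti : forall n, antisymmetric (@ole n);
  ole_trans : forall n, transitive (@ole n);
  ole_total : forall n (e f : edge B n), rng e = rng f -> ole e f || ole f e
}.
Arguments ole {B} w {n} : rename.

Section Orders.
Variables (B : bratteli) (w : bratteli_order B).

Definition max_edge n (e : edge B n) : Prop :=
  forall f : edge B n, rng f = rng e -> ole w f e.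

Definition min_edge n (e : edge B n) : Prop :=
  forall f : edge B n, rng f = rng e -> ole w e f.

Definition max_paths : set (inf_path B) := [set x | forall n, max_edge (x n)].

Definition min_paths : set (inf_path B) := [set x | forall n, min_edge (x n)].

Definition succ_edge n (e f : edge B n) : Prop :=
  [/\ ole w e f, e != f &
      forall g : edge B n, ole w e g -> e != g -> ole w f g].

Definition homeomorphism (T U : topologicalType) (phi : T -> U) : Prop :=
  continuous phi /\
  exists psi : U -> T, [/\ continuous psi, cancel phi psi & cancel psi phi].

Definition vershik_map (phi : inf_path B -> inf_path B) : Prop :=
  [/\ homeomorphism phi,
      phi @` max_paths = min_paths &
      forall (x : inf_path B) (k : nat),
        (forall i, (i < k)%N -> max_edge (x i)) -> ~ max_edge (x k) ->
        [/\ forall i, (i < k)%N -> min_edge (phi x i),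
            succ_edge (x k) (phi x k) &
            forall i, (k < i)%N -> phi x i = x i]].

Definition perfect_order : Prop := exists phi, vershik_map phi.

Definition has_extremal_paths (j : nat) : Prop :=
  max_paths #= `I_j /\ min_paths #= `I_j.

End Orders.

Definition regular_bratteli (B : bratteli) : Prop :=
  forall w : bratteli_order B,
    interior (max_paths w) = set0 /\ interior (min_paths w) = set0.

Section DimensionGroup.
Variable B : bratteli.

Definition incidence n (v : vertex B n.+1) (u : vertex B n) : nat :=
  #|[set e : edge B n | (rng e == v) && (src e == u)]|.

Definition incidence_map n (x : {ffun vertex B n -> int}) :
    {ffun vertex B n.+1 -> int} :=
  [ffun v => \sum_u (incidence v u)%:R * x u].

Lemma incidence_map_additive n : zmod_morphism (@incidence_map n).
Proof.
move=> x y; apply/ffunP => v; rewrite !ffunE -sumrB.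
by apply: eq_bigr => u _; rewrite !ffunE mulrBr.
Qed.

HB.instance Definition _ n :=
  GRing.isZmodMorphism.Build {ffun vertex B n -> int}
    {ffun vertex B n.+1 -> int} (@incidence_map n) (@incidence_map_additive n).

Definition dimgroup : zmodType := 
  @dirlim (fun n => {ffun vertex B n -> int}) (fun n => @incidence_map n).

Definition dimgroup_in n (x : {ffun vertex B n -> int}) : dimgroup :=
  @dirlim_in (fun n => {ffun vertex B n -> int}) (fun n => @incidence_map n) n x.

Definition dimgroup_pos : set dimgroup :=
  [set g | exists n (x : {ffun vertex B n -> int}),
     (forall v, 0 <= x v) /\ g = dimgroup_in x].

Definition dimgroup_unit : dimgroup :=
  dimgroup_in ([ffun=> 1] : {ffun vertex B 0 -> int}).

Definition normalized_trace (R : realType) (tau : {additive dimgroup -> R}) :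
    Prop :=
  (forall g, dimgroup_pos g -> 0 <= tau g) /\ tau dimgroup_unit = 1.

Definition infinitesimals (R : realType) : set dimgroup :=
  [set g | forall tau : {additive dimgroup -> R},
     normalized_trace tau -> tau g = 0].

End DimensionGroup.

Arguments infinitesimals B R : clear implicits.

(* Main.v *)
(* Let X be the path space, phi the Vershik map and psi its inverse. A locally
   constant F : X -> Z has a class in G, obtained by summing F over the finite
   paths ending at each vertex of a high enough level n. In the tower over a
   vertex, phi maps the non-maximal paths bijectively onto the non-minimal ones,
   so the class of the coboundary F - F o psi at a vertex v telescopes to
   F(top of v) - F(psi(bottom of v)).
   This is bounded independently of n, whereas aperiodicity makes the heights of
   the towers, which are the coordinates of the order unit, tend to infinity;
   hence classes of coboundaries are infinitesimal. If the class of F - F o psi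
   vanishes, then the value of F at the top of the tower through x is a
   phi-invariant function of x, hence constant on tail classes and, B being
   simple, constant; so F is constant on the maximal paths. So prescribing F
   on j - 1 of the j maximal paths, with F = 0 at the last one, embeds Z^(j-1)
   into Inf(G). *)
From HB Require Import structures.
Require Import Defs.
From mathcomp Require Import all_boot all_order all_algebra finmap.
From mathcomp Require Import boolp classical_sets functions cardinality.
From mathcomp Require Import reals topology.

Set Implicit Arguments.
Unset Strict Implicit.
Unset Printing Implicit Defensive.

Import Order.TTheory GRing.Theory Num.Theory.
Local Open Scope classical_set_scope.
Local Open Scope ring_scope.

(** * Infinite paths built from tails and finite paths *)

Section Paths.
Variable B : bratteli.
Implicit Types x y z : inf_path B.

Lemma inf_path_ext x y : (forall n, x n = y n) -> x = y.
Proof.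
case: x y => [e he] [f hf] /= ef.
have E : e = f by apply: functional_extensionality_dep.
by subst f; rewrite (Prop_irrelevance he hf).
Qed.

Definition agree n x y := forall i, (i < n)%N -> x i = y i.

Lemma agree_sym n x y : agree n x y -> agree n y x.
Proof. by move=> a i /a. Qed.

Lemma agree_trans n x y z : agree n x y -> agree n y z -> agree n x z.
Proof. by move=> a b i i_n; rewrite a // b. Qed.

Lemma agree_le m n x y : (m <= n)%N -> agree n x y -> agree m x y.
Proof. by move=> mn a i im; apply: a; apply: leq_trans mn. Qed.

Lemma vertex0_eq (u v : vertex B 0) : u = v.
Proof. exact: (fintype_le1P (eq_leq (card_vertex0 B))). Qed.

Lemma agree_src n x y : agree n x y -> src (x n) = src (y n).
Proof.
case: n => [|n] a; first exact: vertex0_eq.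
by rewrite -!path_adj a.
Qed.

Definition is_tail n (t : forall i, edge B i) :=
  forall i, (n <= i)%N -> rng (t i) = src (t i.+1).

(* The edges of [t] below level [m] are junk values. *)
Lemma exists_tail m (u : vertex B m) :
  exists t, src (t m) = u /\ is_tail m t.
Proof.
have [nxt nxtP] : exists nxt : forall i, vertex B i -> edge B i,
    forall i (v : vertex B i), src (nxt i v) = v.
  exists (fun i v => projT1 (cid (src_surj v))) => i v.
  exact: (projT2 (cid (src_surj v))).
have /card_gt0P[v0 _] : (0 < #|vertex B 0|)%N by rewrite card_vertex0.
pose d := nat_rect (vertex B) v0 (fun i v => rng (nxt i v)).
pose du := dfwith d u.
(* A vertex is needed at every level: [s] copies [du] up to level [m], where it equals [u], and
   follows [nxt] from there on. *)
pose s := nat_rect (vertex B) (du 0)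
  (fun i v => if (i < m)%N then du i.+1 else rng (nxt i v)).
have s_du k : (k <= m)%N -> s k = du k by case: k => //= k ->.
have sm : s m = u by rewrite s_du // /du dfwith_in.
exists (fun i => nxt i (s i)); split; first by rewrite nxtP.
by move=> i mi; rewrite nxtP /= ltnNge mi.
Qed.

(** Induction on [n]: an edge satisfying [P] and ending where the tail starts is put in front of it,
    which lowers the starting level by one. With [P] maximality or minimality this yields extremal
    initial segments. *)
Lemma backfill (P : forall n, edge B n -> Prop) :
  (forall n (v : vertex B n.+1), exists e, rng e = v /\ P n e) ->
  forall n t, is_tail n t ->
  exists y, (forall i, (i < n)%N -> P i (y i)) /\
            (forall i, (n <= i)%N -> y i = t i).
Proof.
move=> exP; elim=> [|n IH] t tailt.
  by exists (InfPath (fun i => tailt i (leq0n i))).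
have [e [re Pe]] := exP n (src (t n.+1)).
have t'_out i : (n < i)%N -> dfwith t e i = t i.
  by move=> ni; rewrite dfwith_out // ltn_eqF.
have [|y [yP yt]] := IH (dfwith t e).
  move=> i; rewrite leq_eqVlt => /orP[/eqP <-|ni].
    by rewrite dfwith_in t'_out.
  by rewrite !t'_out ?(ltnW ni) //; [apply: tailt|apply: ltnW].
exists y; split=> i ni.
  have [lt_in|] := ltnP i n; first exact: yP.
  move=> ni'; have E : i = n by apply/eqP; rewrite eqn_leq ni' -ltnS ni.
  by subst i; rewrite yt // dfwith_in.
by rewrite yt ?(ltnW ni) // t'_out.
Qed.

Lemma vertex_path n (v : vertex B n) : exists x, src (x n) = v.
Proof.
have [t [tv tailt]] := exists_tail v.
have exP k (u : vertex B k.+1) : exists e : edge B k, rng e = u /\ True.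
  by have [e] := rng_surj u; exists e.
have [x [_ xt]] := backfill (P := fun _ _ => True) exP tailt.
by exists x; rewrite xt.
Qed.

(** Tuples without adjacency condition, so that the type is finite by construction; [valid] selects
    the actual paths. The root is recorded so that [endp] has a value at length 0. *)
Fixpoint rpath n : finType :=
  if n is k.+1 then (rpath k * edge B k)%type else vertex B 0.

Definition endp n : rpath n -> vertex B n :=
  if n is k.+1 return rpath n -> vertex B n then fun p => rng p.2 else id.

Fixpoint valid n : rpath n -> bool :=
  if n is k.+1 return rpath n -> bool
  then fun p => valid p.1 && (endp p.1 == src p.2) else predT.

Fixpoint trunc x n : rpath n :=
  if n is k.+1 return rpath n then (trunc x k, x k) else src (x 0).

Lemma endp_trunc x n : endp (trunc x n) = src (x n).
Proof. by case: n => //= n; rewrite path_adj. Qed.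

Lemma valid_trunc x n : valid (trunc x n).
Proof. by elim: n => //= n ->; rewrite endp_trunc eqxx. Qed.

Lemma trunc_agree x y n : trunc x n = trunc y n <-> agree n x y.
Proof.
elim: n => [|n IH] /=; first by split=> // _; exact: vertex0_eq.
split=> [[/IH a e] i|a].
  by rewrite ltnS leq_eqVlt => /orP[/eqP ->|/a].
by congr pair; [apply/IH; apply: agree_le a|apply: a].
Qed.

Lemma splice n (p : rpath n) t : valid p -> endp p = src (t n) ->
  is_tail n t -> exists x, trunc x n = p /\ forall i, (n <= i)%N -> x i = t i.
Proof.
elim: n p t => [|n IH] p t.
  move=> _ pt tailt; exists (InfPath (fun i => tailt i (leq0n i))).
  by split=> //=; rewrite pt.
case: p => p e /= /andP[vp /eqP pe] et tailt.
have t'_out i : (n < i)%N -> dfwith t e i = t i.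
  by move=> ni; rewrite dfwith_out // ltn_eqF.
have [||x [xp xt]] := IH p (dfwith t e) vp; first by rewrite dfwith_in.
  move=> i; rewrite leq_eqVlt => /orP[/eqP <-|ni].
    by rewrite dfwith_in t'_out.
  by rewrite !t'_out ?(ltnW ni) //; [apply: tailt|apply: ltnW].
exists x; rewrite xp; split; first by rewrite xt // dfwith_in.
by move=> i ni; rewrite xt ?(ltnW ni) // t'_out.
Qed.

(** One tail is chosen for each vertex and attached to every valid finite path ending there. *)
Lemma exists_tailed_path :
  exists ext : forall n, rpath n -> inf_path B,
    (forall n p, valid p -> trunc (ext n p) n = p) /\
    (forall n (p q : rpath n) i, valid p -> valid q -> endp p = endp q ->
       (n <= i)%N -> ext n p i = ext n q i).
Proof.
pose t n u := projT1 (cid (@exists_tail n u)).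
have tP n u : src (t n u n) = u /\ is_tail n (t n u).
  exact: (projT2 (cid (@exists_tail n u))).
have /card_gt0P[v0 _] : (0 < #|vertex B 0|)%N by rewrite card_vertex0.
have [x0 _] := vertex_path v0.
have /choice[f fP] : forall np : {n & rpath n}, exists x,
    valid (projT2 np) -> trunc x (projT1 np) = projT2 np /\
    forall i, (projT1 np <= i)%N -> x i = t _ (endp (projT2 np)) i.
  move=> [n p] /=; have [vp|_] := boolP (valid p); last by exists x0.
  have [tn tl] := tP n (endp p).
  by have [x xP] := splice vp (esym tn) tl; exists x.
exists (fun n p => f (existT _ n p)); split=> [n p vp|n p q i vp vq pq ni].
  by have [] := fP (existT _ n p) vp.
have [_ ->] := fP (existT _ n p) vp; last by [].
by have [_ ->] := fP (existT _ n q) vq; rewrite //= pq.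
Qed.

(** * Compactness of the path space and uniform continuity *)

(** Koenig's argument: if no depth serves all paths, finiteness of each [edge B n] yields a path all
    of whose initial segments are bad, and some [Q N] holds on that path and on its cylinder of
    depth [N]. *)
Lemma fan (Q : nat -> inf_path B -> Prop) :
  (forall m n x, (m <= n)%N -> Q m x -> Q n x) ->
  (forall n x y, agree n x y -> Q n x -> Q n y) ->
  (forall x, exists n, Q n x) ->
  exists n, forall x, Q n x.
Proof.
move=> Qmono Qloc Qex; apply: contrapT => noN.
have noN' n : exists x, ~ Q n x by apply/existsNP => Qn; apply: noN; exists n.
(* [bad n x]: no [N] works on the whole cylinder of depth [n] around [x]. *)
pose bad n x := forall N, exists y, agree n x y /\ ~ Q N y.
have bad0 x : bad 0 x by move=> N; have [y] := noN' N; exists y.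
have badS n x : bad n x -> exists y, agree n x y /\ bad n.+1 y.
  move=> bad_x; apply: contrapT => nobad.
  (* If no extension by one edge is bad, each edge [e] has its own bound [f e], and the largest of
     these works on the whole cylinder. *)
  have /choice[f fP] : forall e : edge B n, exists N,
      forall y, agree n x y -> y n = e -> Q N y.
    move=> e; apply: contrapT => noQ; apply: nobad.
    have {}noQ N : exists y, [/\ agree n x y, y n = e & ~ Q N y].
      apply: contrapT => noy; apply: noQ; exists N => y xy ye.
      by apply: contrapT => nQ; apply: noy; exists y.
    have [y0 [xy0 y0e _]] := noQ 0; exists y0; split=> // N.
    have [y [xy ye nQy]] := noQ N; exists y; split=> // i.
    rewrite ltnS leq_eqVlt => /orP[/eqP ->|i_n]; first by rewrite ye.
    by rewrite -xy0 // xy.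
  have [y [xy]] := bad_x (\max_e f e)%N; apply.
  by apply: Qmono (fP (y n) y xy erefl); apply: leq_bigmax.
have [x0 _] := noN' 0.
pose step n (s : {x | bad n x}) : {x | bad n.+1 x} :=
  let: exist y yP := cid (badS n _ (projT2 s)) in
  exist _ y (proj2 yP).
pose s := nat_rect (fun n => {x | bad n x}) (exist _ x0 (bad0 x0)) step.
have sS n : agree n (projT1 (s n)) (projT1 (s n.+1)).
  by rewrite /= /step; case: cid => y [].
have s_agree n m : (n <= m)%N -> agree n (projT1 (s n)) (projT1 (s m)).
  elim: m => [|m IH]; first by rewrite leqn0 => /eqP ->.
  rewrite leq_eqVlt => /orP[/eqP <- //|/[!ltnS] nm].
  exact: agree_trans (IH nm) (agree_le nm (sS m)).
have adj n : rng (projT1 (s n.+1) n) = src (projT1 (s n.+2) n.+1).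
  by rewrite -path_adj (s_agree _ _ (leqnSn n.+1) n).
(* The diagonal path: its first [n] edges are those of the [n]-th bad path. *)
pose z := InfPath adj.
have [N QN] := Qex z.
have [y [sy]] := projT2 (s N) N; apply; apply: Qloc QN => i iN /=.
by rewrite (s_agree _ _ iN) // sy.
Qed.

Lemma cylinder_open x n : open (cylinder x n).
Proof.
exists [set cylinder x n]; last by rewrite bigcup_set1.
move=> _ ->; apply: (finI_from1 _ (i := cylinder x n)).
by exists x, n.
Qed.

(** A finite intersection of cylinders containing [x] contains the cylinder around [x] of the
    largest depth involved, so the subbase is in fact a base. *)
Lemma open_cylinder (A : set (inf_path B)) x :
  open A -> A x -> exists n, cylinder x n `<=` A.
Proof.
move=> [D' D'P <-] [C D'C Cx].
have [I IP EC] : exists2 I : {fset set (inf_path B)},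
  {subset I <= @cylinders B} & \bigcap_(i in [set` I]) i = C := D'P _ D'C.
suff [n nC] : exists n, cylinder x n `<=` C.
  by exists n => y /nC Cy; exists C.
have /choice[f fP] : forall i : set (inf_path B), exists n,
    i \in I -> cylinder x n `<=` i.
  move=> i; have [iI|_] := boolP (i \in I); last by exists 0%N.
  have := IP _ iI; rewrite inE => -[z [n Ei]].
  have : i x by move: Cx; rewrite -EC; apply.
  rewrite Ei => xz; exists n => _ y xy k kn.
  by rewrite xy // xz.
exists (\max_(i <- I) f i)%N; rewrite -EC => y xy i /= iI.
apply: fP => // k kn; apply: xy; apply: leq_trans kn _.
exact: leq_bigmax_seq.
Qed.

(** Continuity gives a depth at each point, and [fan] makes it uniform. *)
Lemma continuous_agree (f : inf_path B -> inf_path B) n : continuous f ->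
  exists m, forall x y, agree m x y -> agree n (f x) (f y).
Proof.
move=> cf.
have [|||m mP] := @fan (fun m x => forall y, agree m x y ->
  agree n (f x) (f y)); last by exists m.
- by move=> k m x km H y xy; apply: H; apply: agree_le xy.
- move=> m x y xy H z yz; have xz := agree_trans xy yz.
  exact: agree_trans (agree_sym (H _ xy)) (H _ xz).
- move=> x.
  have /continuousP/(_ _ (cylinder_open (f x) n)) of_ := cf.
  have [|m mP] := open_cylinder (x := x) of_; first by [].
  by exists m => y xy; apply: agree_sym; apply: mP => i im; rewrite xy.
Qed.

End Paths.

(** * Towers, their heights, and classes of locally constant functions *)

Section Towers.
Variable B : bratteli.
Implicit Types (x y z : inf_path B) (F : inf_path B -> int).

(* As the tail of [ext p] depends only on [endp p], the Vershik map sends [ext p],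
   when [p] is not maximal, to a path that is again of the form [ext q]. *)
Definition ext : forall n, rpath B n -> inf_path B :=
  projT1 (cid (exists_tailed_path B)).

Lemma extK n (p : rpath B n) : valid p -> trunc (ext p) n = p.
Proof.
by move=> vp; have [+ _] := projT2 (cid (exists_tailed_path B)); apply.
Qed.

Lemma ext_tail n (p q : rpath B n) i : valid p -> valid q -> endp p = endp q ->
  (n <= i)%N -> ext p i = ext q i.
Proof. by have [_ +] := projT2 (cid (exists_tailed_path B)); apply. Qed.

Lemma endp_ext n (p : rpath B n) : valid p -> src (ext p n) = endp p.
Proof. by move=> vp; rewrite -endp_trunc extK. Qed.

Lemma truncK n (p : rpath B n) x : valid p -> src (x n) = endp p ->
  (forall i, (n <= i)%N -> x i = ext p i) -> ext (trunc x n) = x.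
Proof.
move=> vp xp xt; apply: inf_path_ext => i; have [ni|lt_in] := leqP n i.
  rewrite xt //; apply: ext_tail => //; first exact: valid_trunc.
  by rewrite endp_trunc.
by move: i lt_in; apply/trunc_agree; rewrite extK // valid_trunc.
Qed.

Definition level n F := forall x y, agree n x y -> F x = F y.

Lemma level_le m n F : (m <= n)%N -> level m F -> level n F.
Proof. by move=> mn Fm x y /(agree_le mn)/Fm. Qed.

Lemma level_ext n F x : level n F -> F (ext (trunc x n)) = F x.
Proof. by apply; apply/trunc_agree; rewrite extK // valid_trunc. Qed.

Definition tower n (v : vertex B n) : pred (rpath B n) :=
  fun p => valid p && (endp p == v).

(** For [F] of level [n] the tails chosen by [ext] do not matter, and this vector represents the
    class of [F] in the dimension group. *)
Definition cls n F : {ffun vertex B n -> int} :=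
  [ffun v => \sum_(p | tower v p) F (ext p)].

(** A path of length [n.+1] is a path of length [n] followed by an edge, and the incidence matrix
    counts these edges by source. *)
Lemma incidence_cls n F : level n F -> incidence_map (cls n F) = cls n.+1 F.
Proof.
move=> Fn; apply/ffunP => v; rewrite !ffunE.
transitivity (\sum_(e : edge B n | rng e == v) cls n F (src e)).
  rewrite (partition_big (fun e => src e) predT) //=; apply: eq_bigr => u _.
  rewrite (eq_bigr (fun _ => cls n F u)) => [|e /andP[_ /eqP ->] //].
  rewrite sumr_const -[RHS]mulr_natl; congr (_%:R * _).
  by apply: eq_card => e; apply/idP/idP; rewrite inE.
rewrite (eq_bigr (fun e => \sum_(p | tower (src e) p) F (ext p))); last first.
  by move=> e _; rewrite ffunE.
rewrite (exchange_big_dep predT) //= pair_big_dep /=.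
apply: eq_big => [[p e]|[p e] /andP[/eqP re /andP[vp /eqP pe]]].
  by rewrite /tower /= andbC.
apply: Fn; apply/trunc_agree; rewrite extK //.
have vpe : valid ((p, e) : rpath B n.+1) by rewrite /= vp pe eqxx.
exact: esym (congr1 fst (extK vpe)).
Qed.

Lemma clsB n F G : cls n (fun x => F x - G x) = cls n F - cls n G.
Proof. by apply/ffunP => v; rewrite !ffunE -sumrB. Qed.

Lemma dimgroup_in_cls m n F : level m F -> (m <= n)%N ->
  dimgroup_in (cls n F) = dimgroup_in (cls m F).
Proof.
move=> Fm; elim: n => [|n IH]; first by rewrite leqn0 => /eqP ->.
rewrite leq_eqVlt => /orP[/eqP -> //|/[!ltnS] mn].
rewrite -IH // -incidence_cls; last exact: level_le Fm.
exact: (@dirlim_in_step (fun n => {ffun vertex B n -> int})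
  (fun n => @incidence_map B n)).
Qed.

(** Zero in the direct limit means zero at some later level, and the image of [cls m F] there is
    [cls n F]. *)
Lemma dimgroup_in_cls_eq0 m F : level m F -> dimgroup_in (cls m F) = 0 ->
  exists n, (m <= n)%N /\ cls n F = 0.
Proof.
move=> Fm Fm0; set A := fun n => {ffun vertex B n -> int} : zmodType.
set f : forall n, {additive A n -> A n.+1} := fun n => @incidence_map B n.
have pushF n : (m <= n)%N -> push f (Tagged A (cls m F)) n = cls n F.
  elim: n => [|n IH]; rewrite leq_eqVlt.
    by rewrite orbF => /eqP E; subst m; rewrite push_tag.
  move=> /orP[/eqP E|/[!ltnS] mn]; first by subst m; rewrite push_tag.
  by rewrite pushS // IH // -incidence_cls //; exact: level_le Fm.
have push0 n : push f (Tagged A (0 : A 0%N)) n = 0.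
  elim: n => [|n IH]; first by rewrite push_tag.
  by rewrite pushS // IH raddf0.
have /dirlim_inP[n [mn _]] : dirlim_in f (cls m F) = dirlim_in f (0 : A 0%N).
  exact: Fm0.
by rewrite pushF // push0 => ?; exists n.
Qed.

Definition height n (v : vertex B n) : nat := #|tower v|.

Lemma cls1 n (v : vertex B n) : cls n (fun=> 1) v = (height v)%:Z.
Proof. by rewrite ffunE sumr_const -natz. Qed.

(** Serves to extract the top or the bottom of a tower, [P] being maximality or minimality. *)
Lemma sum_tower_unique n (P : pred (rpath B n)) F y :
  level n F -> (P (trunc y n)) ->
  (forall p, valid p -> endp p = src (y n) -> P p -> p = trunc y n) ->
  \sum_(p | tower (src (y n)) p && P p) F (ext p) = F y.
Proof.
move=> Fn Py uniq; rewrite (big_pred1 (trunc y n)) ?level_ext // => p /=.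
apply/idP/eqP => [/andP[/andP[vp /eqP pe]]|->]; first exact: uniq.
by rewrite /tower valid_trunc endp_trunc eqxx.
Qed.

Lemma height_edge n (e : edge B n) : (height (src e) <= height (rng e))%N.
Proof.
have inj_e : injective (fun p : rpath B n => (p, e) : rpath B n.+1).
  by move=> p q [].
rewrite /height -(fintype.card_image inj_e).
apply: subset_leq_card; apply/fintype.subsetP => _ /fintype.imageP[p + ->].
by rewrite /tower !unfold_in /= eqxx andbT.
Qed.

Lemma height_path x m n : (m <= n)%N ->
  (height (src (x m)) <= height (src (x n)))%N.
Proof.
elim: n => [|n IH]; first by rewrite leqn0 => /eqP ->.
rewrite leq_eqVlt => /orP[/eqP <- //|/[!ltnS] /IH h].
by rewrite -path_adj; apply: leq_trans h (height_edge _).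
Qed.

(** Aperiodicity gives [K] paths tail equivalent to [x]. At a level where all have merged with [x],
    their initial segments are [K] elements of the tower through [x]. Compactness makes the level
    uniform. *)
Lemma height_unbounded (K : nat) : aperiodic B ->
  exists n, forall v : vertex B n, (K <= height v)%N.
Proof.
move=> aper.
have [|||n hn] := @fan B (fun n x => K <= height (src (x n)))%N.
- by move=> m n x mn h; apply: leq_trans h (height_path x mn).
- by move=> n x y /agree_src ->.
- move=> x; have [D Dx KD] := infinite_set_fset K (aper x).
  pose f := nth x D.
  have /choice[N NP] : forall i, exists n, (i < K)%N ->
      forall k, (n <= k)%N -> x k = f i k.
    move=> i; have [iK|_] := ltnP i K; last by exists 0%N.
    have [|N _ NP] := Dx (f i); last by exists N.
    by apply: mem_nth; apply: leq_trans KD.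
  pose n := (\max_(i < K) N i)%N; exists n.
  have fx (i : 'I_K) k : (n <= k)%N -> x k = f i k.
    move=> nk; apply: NP => //; apply: leq_trans nk.
    exact: (leq_bigmax (F := fun i : 'I_K => N i)).
  (* The paths coincide from level [n] on, so distinct ones already differ below it. *)
  have inj_f : injective (fun i : 'I_K => trunc (f i) n).
    move=> i k /trunc_agree fik; apply: val_inj => /=.
    apply/eqP; rewrite -(nth_uniq x (s := D)) ?(leq_trans _ KD) ?fset_uniq //.
    apply/eqP; apply: inf_path_ext => l.
    by have [nl|/fik //] := leqP n l; rewrite -(fx i l nl) -(fx k l nl).
  rewrite -[leqLHS]card_ord -(fintype.card_image inj_f).
  apply: subset_leq_card; apply/fintype.subsetP => _ /fintype.imageP[i _ ->].
  by rewrite unfold_in /tower valid_trunc endp_trunc -(fx i n (leqnn n)) /=.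
by exists n => v; have [x <-] := vertex_path v.
Qed.

End Towers.

(** * Traces of bounded vectors *)

Lemma dimgroup_in_additive (B : bratteli) n : zmod_morphism (@dimgroup_in B n).
Proof.
exact: (@dirlim_in_additive (fun n => {ffun vertex B n -> int})
  (fun n => @incidence_map B n)).
Qed.

HB.instance Definition _ (B : bratteli) n :=
  GRing.isZmodMorphism.Build {ffun vertex B n -> int} (dimgroup B)
    (@dimgroup_in B n) (@dimgroup_in_additive B n).

(** The vector [h] of heights represents the order unit, and [h *+ c - g *+ K] has nonnegative
    coordinates, hence nonnegative trace; this is applied to [f] and to its opposite. *)
Lemma trace_bound (B : bratteli) (R : realType)
    (tau : {additive dimgroup B -> R}) n (f : {ffun vertex B n -> int})
    (c K : nat) :
  normalized_trace tau -> (forall v, `|f v| <= c%:Z) ->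
  (forall v : vertex B n, K <= height v)%N ->
  K%:R * `|tau (dimgroup_in f)| <= c%:R.
Proof.
move=> [tau_ge0 tau1] fc Kh.
pose h : {ffun vertex B n -> int} := cls n (fun=> 1).
have tau_h : tau (dimgroup_in h) = 1.
  rewrite -tau1 /h (@dimgroup_in_cls _ 0) //; congr (tau (dimgroup_in _)).
  apply/ffunP => v; rewrite cls1 ffunE.
  suff -> : height v = 1%N by [].
  rewrite /height -(card_vertex0 B); apply: eq_card => u.
  by rewrite /tower !unfold_in /=; apply/eqP; exact: vertex0_eq.
have le_tau (g : {ffun vertex B n -> int}) : (forall v, `|g v| <= c%:Z) ->
    K%:R * tau (dimgroup_in g) <= c%:R.
  move=> gc; have : 0 <= tau (dimgroup_in (h *+ c - g *+ K)).
    apply: tau_ge0; exists n, (h *+ c - g *+ K); split=> // v.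
    rewrite !ffunE !ffunMnE cls1 subr_ge0.
    apply: (@le_trans _ _ (`|g v| *+ K)).
      by rewrite lerMn2r ler_norm orbT.
    apply: (@le_trans _ _ (c%:Z *+ K)); first by rewrite lerMn2r gc orbT.
    rewrite -[leLHS]mulr_natr -[leRHS]mulr_natr !natz -!PoszM lez_nat mulnC.
    by rewrite leq_mul2r Kh orbT.
  rewrite !raddfB !raddfMn /= mulNrn tau_h subr_ge0.
  by rewrite mulr_natl.
rewrite -[X in X * _]normr_nat -normrM ler_norml le_tau // andbT.
rewrite lerNl -mulrN.
rewrite -[- tau _](raddfN tau) -[- dimgroup_in _](raddfN (@dimgroup_in B n)).
by apply: le_tau => v; rewrite ffunE normrN.
Qed.

(** * Extremal edges and extremal initial segments *)

Section ExtremalEdges.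
Variables (B : bratteli) (w : bratteli_order B).

(** The edge of the fibre with the most edges below it is maximal. *)
Lemma exists_max_edge n (v : vertex B n.+1) :
  exists e, rng e = v /\ max_edge w e.
Proof.
have [e0 /eqP re0] := rng_surj v.
pose M (e : edge B n) := #|[pred f | ole w f e]|.
have [e /eqP re maxe] := @arg_maxnP _ e0 (fun e => rng e == v) M re0.
exists e; split=> // f rf.
have /orP[//|ef] : ole w f e || ole w e f by apply: ole_total.
have /maxe : rng f == v by rewrite rf re.
rewrite /= leqNgt; apply: contraNT => nfe; apply: proper_card.
apply/fintype.properP; split.
  by apply/fintype.subsetP => g /= ge; apply: ole_trans ge ef.
by exists f; rewrite !inE // ole_refl.
Qed.

Lemma exists_min_edge n (v : vertex B n.+1) :
  exists e, rng e = v /\ min_edge w e.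
Proof.
have [e0 /eqP re0] := rng_surj v.
pose M (e : edge B n) := #|[pred f | ole w f e]|.
have [e /eqP re mine] := @arg_minnP _ e0 (fun e => rng e == v) M re0.
exists e; split=> // f rf.
have /orP[//|fe] : ole w e f || ole w f e by apply: ole_total.
have /mine : rng f == v by rewrite rf re.
rewrite /= leqNgt; apply: contraNT => nef; apply: proper_card.
apply/fintype.properP; split.
  by apply/fintype.subsetP => g /= gf; apply: ole_trans gf fe.
by exists e; rewrite !inE // ole_refl.
Qed.

Lemma max_edge_inj n (e f : edge B n) :
  max_edge w e -> max_edge w f -> rng e = rng f -> e = f.
Proof. by move=> Me Mf ef; apply: (@ole_anti _ w); rewrite Mf ?Me. Qed.

Lemma min_edge_inj n (e f : edge B n) :
  min_edge w e -> min_edge w f -> rng e = rng f -> e = f.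
Proof. by move=> Me Mf ef; apply: (@ole_anti _ w); rewrite Me ?Mf. Qed.

Definition below (P : forall n, edge B n -> Prop) n (x : inf_path B) :=
  forall i, (i < n)%N -> P i (x i).

(** An edge satisfying [P] is fixed by its range, and its source is the range of the previous edge;
    so the segment is determined downwards from its vertex at level [n]. *)
Lemma below_inj (P : forall n, edge B n -> Prop) :
  (forall n (e f : edge B n), P n e -> P n f -> rng e = rng f -> e = f) ->
  forall n x y, below P n x -> below P n y -> src (x n) = src (y n) ->
  agree n x y.
Proof.
move=> Pinj; elim=> [//|n IH] x y Px Py xy i.
have xyn : x n = y n by apply: Pinj; rewrite ?path_adj; auto.
rewrite ltnS leq_eqVlt => /orP[/eqP -> //|].
by apply: IH; rewrite ?xyn // => k kn; [apply: Px|apply: Py]; apply: ltnW.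
Qed.

Definition xmax := below (@max_edge B w).
Definition xmin := below (@min_edge B w).

Lemma xmax_agree n x y : xmax n x -> xmax n y -> src (x n) = src (y n) ->
  agree n x y.
Proof. exact: below_inj max_edge_inj _ _ _. Qed.

Lemma xmin_agree n x y : xmin n x -> xmin n y -> src (x n) = src (y n) ->
  agree n x y.
Proof. exact: below_inj min_edge_inj _ _ _. Qed.

Lemma exists_xmax n (x : inf_path B) :
  exists y, xmax n y /\ (forall i, (n <= i)%N -> y i = x i).
Proof.
exact: backfill (@exists_max_edge) _ x (fun i _ => path_adj x i).
Qed.

Lemma exists_xmin n (x : inf_path B) :
  exists y, xmin n y /\ (forall i, (n <= i)%N -> y i = x i).
Proof.
exact: backfill (@exists_min_edge) _ x (fun i _ => path_adj x i).
Qed.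

End ExtremalEdges.

(** * Coboundaries and invariant functions of the Vershik map *)

Section Vershik.
Variables (B : bratteli) (w : bratteli_order B).
Variables (phi psi : inf_path B -> inf_path B).
Hypotheses (phiK : cancel phi psi) (psiK : cancel psi phi).
Hypothesis phi_max : phi @` max_paths w = min_paths w.
Hypothesis phi_step : forall (x : inf_path B) k,
  (forall i, (i < k)%N -> max_edge w (x i)) -> ~ max_edge w (x k) ->
  [/\ forall i, (i < k)%N -> min_edge w (phi x i),
      succ_edge w (x k) (phi x k) &
      forall i, (k < i)%N -> phi x i = x i].

Lemma succ_not_min n (e f : edge B n) : succ_edge w e f -> ~ min_edge w f.
Proof.
move=> [ef /eqP nef _] minf; apply: nef; apply: (@ole_anti _ w).
by rewrite ef minf // (ole_rng ef).
Qed.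

Lemma first_nonmax n x : ~ xmax w n x ->
  exists k, [/\ (k < n)%N, xmax w k x & ~ max_edge w (x k)].
Proof.
move=> nmax; have exk : exists k, (k < n)%N && `[< ~ max_edge w (x k) >].
  apply: contrapT => nok; apply: nmax => i i_n; apply: contrapT => nmi.
  by apply: nok; exists i; rewrite i_n; apply/asboolP.
case: (ex_minnP exk) => k /andP[kn /asboolP nmk] mink.
exists k; split=> // i ik; apply: contrapT => nmi.
have : (k <= i)%N by apply: mink; rewrite (ltn_trans ik kn); apply/asboolP.
by rewrite leqNgt ik.
Qed.

(** If [x] is not maximal throughout, its first non-maximal edge has index at least [n], and [phi x]
    is minimal before it. *)
Lemma phi_xmax n x : xmax w n x -> xmin w n (phi x).
Proof.
move=> maxx; have [xmax'|] := pselect (forall k, max_edge w (x k)).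
  have : min_paths w (phi x) by rewrite -phi_max; exists x.
  by move=> h i _; apply: h.
move=> /existsNP[m nm].
have [|k [_ maxk nmk]] := @first_nonmax m.+1 x; first by move/(_ m (ltnSn m)).
have nk : (n <= k)%N by rewrite leqNgt; apply/negP => /maxx.
have [minphi _ _] := phi_step maxk nmk.
by move=> i i_n; apply: minphi; apply: leq_trans nk.
Qed.

(** The first non-maximal edge has index less than [n]; [phi] replaces it by its successor, which is
    not minimal, and keeps all later edges. *)
Lemma phi_not_xmax n x : ~ xmax w n x ->
  ~ xmin w n (phi x) /\ forall i, (n <= i)%N -> phi x i = x i.
Proof.
move=> /first_nonmax[k [kn maxk nmk]].
have [_ /succ_not_min nmin tl] := phi_step maxk nmk.
split=> [/(_ k kn) //|i ni]; apply: tl.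
exact: leq_trans ni.
Qed.

Lemma psi_not_xmin n x : ~ xmin w n x ->
  ~ xmax w n (psi x) /\ forall i, (n <= i)%N -> psi x i = x i.
Proof.
move=> nmin; have nmax : ~ xmax w n (psi x).
  by move=> /phi_xmax; rewrite psiK.
split=> // i ni; have [_ tl] := phi_not_xmax nmax.
by rewrite -tl // psiK.
Qed.

(* Within a tower [phi] maps the non-maximal paths bijectively onto the
   non-minimal ones, so the sum of a coboundary telescopes. *)
Lemma cls_coboundary n F y z : level n F -> level n (F \o psi) ->
  xmax w n y -> xmin w n z -> src (y n) = src (z n) ->
  cls n (fun x => F x - F (psi x)) (src (y n)) = F y - F (psi z).
Proof.
move=> Fn Fpsin maxy minz yz; rewrite ffunE sumrB.
rewrite (bigID (fun p => `[< xmax w n (ext p) >])) /=.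
rewrite sum_tower_unique //; first last.
- move=> p vp pe /asboolP maxp; rewrite -[LHS]extK //; apply/trunc_agree.
  by apply: xmax_agree maxp maxy _; rewrite endp_ext.
- apply/asboolP => i i_n; suff -> : ext (trunc y n) i = y i by apply: maxy.
  by move: i i_n; apply/trunc_agree; rewrite extK // valid_trunc.
rewrite [X in _ - X](bigID (fun p => `[< xmin w n (ext p) >])) /=.
rewrite yz (sum_tower_unique (F := F \o psi)) //; first last.
- move=> p vp pe /asboolP minp; rewrite -[LHS]extK //; apply/trunc_agree.
  by apply: xmin_agree minp minz _; rewrite endp_ext.
- apply/asboolP => i i_n; suff -> : ext (trunc z n) i = z i by apply: minz.
  by move: i i_n; apply/trunc_agree; rewrite extK // valid_trunc.
rewrite opprD addrACA -[RHS]addr0; congr (_ + _); apply/eqP.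
rewrite subr_eq0; apply/eqP.
set v := src (z n).
have phi_ext p : tower v p -> ~ xmax w n (ext p) ->
    ext (trunc (phi (ext p)) n) = phi (ext p) /\ src (phi (ext p) n) = v.
  move=> /andP[vp /eqP pv] /phi_not_xmax[_ tl].
  by rewrite (truncK vp) // tl // endp_ext.
have psi_ext p : tower v p -> ~ xmin w n (ext p) ->
    ext (trunc (psi (ext p)) n) = psi (ext p) /\ src (psi (ext p) n) = v.
  move=> /andP[vp /eqP pv] /psi_not_xmin[_ tl].
  by rewrite (truncK vp) // tl // endp_ext.
(* The sum over non-maximal paths is reindexed by the non-minimal ones. Truncating loses nothing, as
   [phi (ext p)] and [psi (ext q)] keep the chosen tail and so are again values of [ext]. *)
rewrite (reindex_onto (fun q => trunc (psi (ext q)) n)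
                      (fun p => trunc (phi (ext p)) n)); last first.
  move=> p /andP[vp /asboolPn nmax]; have [-> _] := phi_ext p vp nmax.
  by rewrite phiK extK //; case/andP: vp.
apply: eq_big => [q|q /andP[/andP[]]].
  apply/idP/idP.
    move=> /andP[/andP[vq /asboolPn nmax] /eqP qq].
    have [E1 E2] := phi_ext _ vq nmax; rewrite -qq.
    rewrite {1}/tower valid_trunc endp_trunc E2 eqxx /= E1.
    by apply/asboolPn; have [] := phi_not_xmax nmax.
  move=> /andP[vq /asboolPn nmin]; have [E1 E2] := psi_ext _ vq nmin.
  rewrite {1}/tower valid_trunc endp_trunc E2 eqxx /= E1 psiK.
  rewrite extK ?eqxx ?andbT; last by case/andP: vq.
  by apply/asboolPn; have [] := psi_not_xmin nmin.
move=> vq /asboolPn nmax /eqP qq.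
have [E1 E2] := phi_ext _ vq nmax.
by rewrite -[in RHS]qq /= E1 phiK.
Qed.

(* Moving up within a tower: each application of [phi] to a path that is maximal
   below [m] but not at [m] replaces its edge at [m] by the successor. *)
Lemma invariant_xmax (T : Type) (E : inf_path B -> T) m :
  (forall x, E (phi x) = E x) ->
  forall x, exists y,
    [/\ E y = E x, xmax w m y & forall i, (m <= i)%N -> y i = x i].
Proof.
move=> Ephi; elim: m => [|m IH] x; first by exists x.
(* Inner induction on the number of edges at or above [x m]; passing to the successor removes [x m]
   itself from this set. *)
have [c] := ubnP #|[pred f | ole w (x m) f]|; elim: c x => // c IHc x.
rewrite ltnS => le_c; have [y [Ey maxy yx]] := IH x.
have [maxym|nmax] := pselect (max_edge w (y m)).
  exists y; split=> // [i|i /ltnW/yx //].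
  by rewrite ltnS leq_eqVlt => /orP[/eqP ->|/maxy].
have [_ [le_y neq_y _] tl] := phi_step maxy nmax.
rewrite yx // in le_y neq_y.
have [|z [Ez maxz zx]] := IHc (phi y).
  apply: leq_trans le_c; apply: proper_card; apply/fintype.properP; split.
    by apply/fintype.subsetP => f /= yf; apply: ole_trans le_y yf.
  exists (x m); rewrite !inE ?ole_refl //.
  apply: contra neq_y => ge_y; apply/eqP; apply: (@ole_anti _ w).
  by rewrite le_y.
exists z; split=> //; first by rewrite Ez Ephi.
by move=> i mi; rewrite zx // tl // yx // ltnW.
Qed.

(** Both paths can be moved to a maximal segment below level [m] without changing [E] or the tail,
    and then they coincide. *)
Lemma invariant_tail (T : Type) (E : inf_path B -> T) m
    (x y : inf_path B) :
  (forall x, E (phi x) = E x) -> (forall i, (m <= i)%N -> x i = y i) ->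
  E x = E y.
Proof.
move=> Ephi xy; have [x' [<- maxx x'x]] := invariant_xmax m Ephi x.
have [y' [<- maxy y'y]] := invariant_xmax m Ephi y.
congr E; apply: inf_path_ext => i; have [mi|] := leqP m i.
  by rewrite x'x // y'y // xy.
by move: i; apply: xmax_agree maxx maxy _; rewrite x'x // y'y // xy.
Qed.

Lemma joined_valid n (u : vertex B n) m (v : vertex B m) : joined u v ->
  forall p : rpath B n, valid p -> endp p = u ->
  exists q : rpath B m, [/\ valid q, endp q = v &
    forall z, trunc z m = q -> trunc z n = p].
Proof.
elim=> [|k e _ IH] p vp pu; first by exists p.
have [q [vq qe qp]] := IH p vp pu.
exists ((q, e) : rpath B k.+1); split; rewrite /= ?vq ?qe ?eqxx //.
by move=> z /(congr1 fst)/qp.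
Qed.

(** By simplicity some path agrees with [x] to depth [n] and with [y] from some level on. *)
Lemma invariant_constant (T : Type) (E : inf_path B -> T) n :
  simple_bratteli B -> (forall x, E (phi x) = E x) ->
  (forall x y, agree n x y -> E x = E y) -> forall x y, E x = E y.
Proof.
move=> simpleB Ephi En x y; have [m _ jm] := simpleB n.
have [q [vq qy qx]] := joined_valid (jm (src (x n)) (src (y m)))
  (valid_trunc x n) (endp_trunc x n).
have [z [/qx /trunc_agree zx zy]] := splice vq qy (fun i _ => path_adj y i).
by rewrite -(En _ _ zx); apply: invariant_tail zy.
Qed.

Lemma coboundary_eq0_max n F : simple_bratteli B ->
  level n F -> level n (F \o psi) ->
  cls n (fun x => F x - F (psi x)) = 0 ->
  {in max_paths w &, forall x y, F x = F y}.
Proof.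
move=> simpleB Fn Fpsin cls0.
have /choice[top topP] := @exists_xmax B w n.
have top_xmax x : xmax w n x -> agree n (top x) x.
  move=> maxx; have [mt tx] := topP x.
  by apply: xmax_agree mt maxx _; rewrite tx.
have top_agree (x y : inf_path B) :
    src (x n) = src (y n) -> agree n (top x) (top y).
  move=> xy; have [mx tx] := topP x; have [my ty] := topP y.
  by apply: xmax_agree mx my _; rewrite tx ?ty.
have Ephi x : F (top (phi x)) = F (top x).
  have [maxx|nmax] := pselect (xmax w n x).
    (* Here [phi x] is the bottom of its tower and [psi] sends it back to [x], so the vanishing
       coordinate equates the values of [F] at [top (phi x)] and at [x]. *)
    have [my ty] := topP (phi x).
    have := cls_coboundary Fn Fpsin my (phi_xmax maxx).
    rewrite phiK cls0 ffunE (Fn _ _ (top_xmax _ maxx)) ty // => /(_ erefl).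
    by move/eqP; rewrite eq_sym subr_eq0 => /eqP.
  (* Otherwise [x] and [phi x] lie in the same tower and have the same top. *)
  by apply/Fn/top_agree; have [_ ->] := phi_not_xmax nmax.
move=> x y /set_mem maxx /set_mem maxy.
rewrite -(Fn (top x) x); last by apply: top_xmax => i _.
rewrite -(Fn (top y) y); last by apply: top_xmax => i _.
apply: (invariant_constant (E := F \o top) (n := n) simpleB Ephi).
move=> u v /agree_src uv.
by apply: Fn; apply: top_agree.
Qed.

(** Each coordinate is a difference of two values of [F], however high the tower. *)
Lemma coboundary_bound n F (c : nat) : level n F -> level n (F \o psi) ->
  (forall x, `|F x| <= c%:Z) ->
  forall v, `|cls n (fun x => F x - F (psi x)) v| <= (2 * c)%:Z.
Proof.
move=> Fn Fpsin Fc v; have [x <-] := vertex_path v.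
have [y [maxy yx]] := exists_xmax w n x.
have [z [minz zx]] := exists_xmin w n x.
rewrite -yx // (cls_coboundary Fn Fpsin maxy minz) ?yx ?zx //.
by apply: le_trans (ler_normB _ _) _; rewrite mul2n -addnn PoszD lerD.
Qed.

(* In a level with all towers of height at least [K], a coboundary has class at
   most [2c / K] times the order unit. *)
Lemma coboundary_infinitesimal (R : realType) n F (c : nat) : aperiodic B ->
  level n F -> level n (F \o psi) -> (forall x, `|F x| <= c%:Z) ->
  infinitesimals B R (dimgroup_in (cls n (fun x => F x - F (psi x)))).
Proof.
move=> aper Fn Fpsin Fc tau ntau.
set g := dimgroup_in _; apply/eqP; apply: contraT => tau_g.
(* With all towers of height at least this [K], a nonzero [tau g] violates [trace_bound]. *)
have [K Kc] : exists K : nat, (2 * c)%:R / `|tau g| < K%:R.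
  by eexists; apply: archi_boundP; rewrite divr_ge0.
have [m mK] := height_unbounded K aper.
have Fl k : (n <= k)%N -> level k F /\ level k (F \o psi).
  by move=> nk; split; apply: level_le nk _.
have [Fnm Fpsinm] := Fl (maxn n m) (leq_maxl n m).
have g_eq : g = dimgroup_in (cls (maxn n m) (fun x => F x - F (psi x))).
  rewrite (@dimgroup_in_cls _ n) ?leq_maxl // => x y xy.
  by rewrite (Fn _ _ xy); congr (_ - _); apply: Fpsin.
have hK (v : vertex B (maxn n m)) : (K <= height v)%N.
  have [x <-] := vertex_path v.
  exact: leq_trans (mK _) (height_path x (leq_maxr n m)).
have := trace_bound ntau (coboundary_bound Fnm Fpsinm Fc) hK.
by rewrite -g_eq -ler_pdivlMr ?normr_gt0 // leNgt Kc.
Qed.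

End Vershik.

(** * The image of an additive map as a subgroup *)

Section AdditiveImage.
Variables (U V : zmodType) (h : {additive U -> V}).

Definition additive_image : {pred V} := fun v => `[< exists u, h u = v >].

Lemma additive_image_closed : zmod_closed additive_image.
Proof.
split; first by apply/asboolP; exists 0; rewrite raddf0.
move=> _ _ /asboolP[u <-] /asboolP[v <-]; apply/asboolP.
by exists (u - v); rewrite raddfB.
Qed.

HB.instance Definition _ :=
  GRing.isZmodClosed.Build V additive_image additive_image_closed.

End AdditiveImage.

(** * Separation of the maximal paths and the embedding *)

Lemma separating_level (B : bratteli) j (a : nat -> inf_path B) :
  {in `I_j &, injective a} ->
  exists N, forall i k, (i < j)%N -> (k < j)%N -> agree N (a i) (a k) -> i = k.
Proof.
move=> inj_a; have /choice[N NP] : forall ik : 'I_j * 'I_j, exists n,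
    agree n (a ik.1) (a ik.2) -> ik.1 = ik.2.
  move=> [i k] /=; have [->|nik] := eqVneq i k; first by exists 0%N.
  apply: contrapT => /forallNP nN; move/eqP: nik; apply.
  apply: val_inj; apply: inj_a; rewrite ?inE //=; apply: inf_path_ext => n.
  by apply: contrapT => an; apply: (nN n.+1) => /(_ n (ltnSn n)).
exists (\max_ik N ik)%N => i k ij kj aik.
suff /(congr1 val) : Ordinal ij = Ordinal kj by [].
by apply: (NP (_, _)); apply: agree_le aik; apply: leq_bigmax.
Qed.

Theorem theorem5p1 (R : realType) (B : bratteli)
    (noisolated : isolated [set: inf_path B] = set0)
    (aperiodicB : aperiodic B) (regularB : regular_bratteli B)
    (simpleB : simple_bratteli B)
    (j : nat) (j_ge2 : (2 <= j)%N) (w : bratteli_order B)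
    (perfectw : perfect_order w) (extremalw : has_extremal_paths w j) :
  exists (H : zmodClosed (dimgroup B))
         (h : {additive 'rV[int]_(j - 1) -> dimgroup B}),
    [set` H] `<=` infinitesimals B R /\
    set_bij [set: 'rV[int]_(j - 1)] [set` H] h.
Proof.
case: perfectw => phi [[_ [psi [cpsi phiK psiK]]] phi_max phi_step].
have [a a_max a_inj] : exists2 a : nat -> inf_path B,
    forall i, (i < j)%N -> max_paths w (a i) & {in `I_j &, injective a}.
  have [/card_set_bijP[f [_ _ f_surj]] _] := extremalw.
  have [x0 _ _] := f_surj 0%N (ltn_trans (ltnSn 0) j_ge2).
  have /choice[a aP] : forall i, exists x,
      (i < j)%N -> max_paths w x /\ f x = i.
    (* Indices from [j] on get the junk value [x0]. *)
    move=> i; have [/f_surj[x]|_] := ltnP i j; last by exists x0.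
    by exists x.
  exists a => [i /aP[]//|i k /set_mem /= ij /set_mem /= kj aik].
  by have [_ <-] := aP i ij; have [_ <-] := aP k kj; rewrite aik.
have [N sepN] := separating_level a_inj.
(* By the choice of [N] the cylinders of depth [N] around the maximal paths are disjoint; [F c] is
   [c 0 i] on the [i]-th one and 0 elsewhere, in particular at the last maximal path [a (j - 1)]. *)
pose F (c : 'rV[int]_(j - 1)) x : int :=
  \sum_(i < j - 1) c 0 i * (`[< agree N (a i) x >])%:R.
have F_N c : level N (F c).
  move=> x y xy; apply: eq_bigr => i _; congr (_ * _%:R).
  congr nat_of_bool; apply: asbool_equiv_eq; split=> h.
    exact: agree_trans xy.
  exact: agree_trans (agree_sym xy).
have ltj (i : 'I_(j - 1)) : (i < j)%N by apply: leq_trans (leq_subr 1 j).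
have lt_last : (j - 1 < j)%N by rewrite ltn_subrL (ltnW j_ge2).
have F_a c (i : 'I_(j - 1)) : F c (a i) = c 0 i.
  rewrite /F (bigD1 i) //= asboolT // mulr1 big1 ?addr0 // => k.
  apply: contraNeq; rewrite mulf_eq0 negb_or => /andP[_].
  by case: asboolP => // /sepN ki _; apply/eqP/val_inj/ki.
have F_last c : F c (a (j - 1)%N) = 0.
  rewrite /F big1 // => i _; case: asboolP => [/sepN E|]; last by rewrite mulr0.
  by have := ltn_ord i; rewrite E ?ltnn.
have FB c d x : F (c - d) x = F c x - F d x.
  rewrite /F -sumrB; apply: eq_bigr => i _.
  by rewrite !mxE mulrBl.
have F_bound c x : `|F c x| <= (\sum_i `|c 0%R i|)%N%:Z.
  rewrite -natz natr_sum; apply: le_trans (ler_norm_sum _ _ _) _.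
  apply: ler_sum => i _; rewrite normrM [leRHS]natz abszE ler_piMr //.
  by case: asboolP => _; rewrite ?normr1 ?normr0.
have [M psiM] := continuous_agree N cpsi.
(* Depth [N] suffices for [F c] and depth [M] for [F c \o psi]. Neither depends on [c], so a single
   level defines the additive map [h]. *)
pose n := maxn N M.
have Fk c k : (n <= k)%N -> level k (F c) /\ level k (F c \o psi).
  rewrite geq_max => /andP[Nk Mk]; split=> x y xy.
    exact: level_le Nk (F_N c) _ _ xy.
  by apply: F_N; apply: psiM; apply: agree_le xy.
pose D c x := F c x - F c (psi x).
have DB c d : cls n (D (c - d)) = cls n (D c) - cls n (D d).
  rewrite -clsB; congr cls; apply: funext => x.
  by rewrite /D !FB opprD opprK addrACA; congr (_ + _); rewrite opprB addrC.
pose h0 c := dimgroup_in (cls n (D c)).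
have h0B : zmod_morphism h0.
  by move=> c d; rewrite /h0 DB raddfB.
pose h : {additive 'rV[int]_(j - 1) -> dimgroup B} :=
  HB.pack h0 (GRing.isZmodMorphism.Build _ _ h0 h0B).
have h_eq0 c : h c = 0 -> c = 0.
  have [Fn Fpsin] := Fk c n (leqnn n).
  move=> /dimgroup_in_cls_eq0[|k [nk clsk]].
    by move=> x y xy; rewrite /D (Fn _ _ xy); congr (_ - _); apply: Fpsin.
  have [Fck Fpsik] := Fk c k nk.
  have F_const :=
    coboundary_eq0_max phiK psiK phi_max phi_step simpleB Fck Fpsik clsk.
  (* [F c] is constant on the maximal paths and vanishes at the last one, so every [c 0 i] is 0. *)
  apply/rowP => i; rewrite mxE -F_a -(F_last c); apply: F_const.
    exact/mem_set/a_max.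
  exact/mem_set/a_max.
exists (GRing.ZmodClosed.clone _ (additive_image h) _), h; split.
  move=> _ /asboolP[c <-]; have [Fn Fpsin] := Fk c n (leqnn n).
  exact: (coboundary_infinitesimal phiK psiK phi_max phi_step aperiodicB
    Fn Fpsin (F_bound c)).
split.
- by move=> c _; apply/asboolP; exists c.
- move=> c d _ _ hcd; apply/eqP; rewrite -subr_eq0; apply/eqP/h_eq0.
  by rewrite raddfB hcd subrr.
- by move=> _ /asboolP[c <-]; exists c.
Qed.
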